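(* Let $f:X\to X$ be a homeomorphism of a compact zero-dimensional (Hausdorff) space $X$. Let $\pi:\mathbb Z\times X\to X$, $(t,x)\mapsto f^t(x)$; $\pi_+:\mathbb Z_+\times X\to X$, $(t,x)\mapsto f^t(x)$; and $\pi_-:X\times\mathbb Z_+\to X$, $(x,t)\mapsto f^{-t}(x)$. Then the following are pairwise equivalent: (1) $\pi_+$ is pointwise recurrent. (2) $\pi_-$ is pointwise recurrent. (3) $\pi_+$ is weakly almost periodic. (4) $\pi_-$ is weakly almost periodic. (5) $\pi$ is weakly almost periodic. (6) $(f,X)$ (equivalently $\pi$) is pointwise recurrent.
   Context: $\mathbb Z_+=\{0,1,2,\dots\}$ and $\mathbb Z$ are additive and discrete; $\mathscr U_X$ is the compatible uniformity of $X$, $\alpha[x]=\{y:(x,y)\in\alpha\}$. $\pi_+$ is recurrent at $x$ if there is a net $t_n\to+\infty$ in $\mathbb Z_+$ with $f^{t_n}(x)\to x$; $\pi_-$ is recurrent at $x$ if there is a net $t_n\to+\infty$ in $\mathbb Z_+$ with $f^{-t_n}(x)\to x$; $(f,X)$ (i.e. $\pi$) is recurrent at $x$ if both $\pi_+$ and $\pi_-$ are recurrent at $x$. ''Pointwise recurrent'' means recurrent at every point of $X$. An action $(t,x)\mapsto tx$ of a topological semigroup $T$ on $X$ is weakly almost periodic (in Gottschalk's sense) if for every $\alpha\in\mathscr U_X$ there is a compact subset $K$ of $T$ (here: a finite subset of $\mathbb Z_+$ or $\mathbb Z$ respectively) such that $Ktx\cap\alpha[x]\ne\emptyset$ for all $x\in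 X$ and all $t\in T$; here $Ktx=\{ktx:k\in K\}$, and for $\pi_-$ the element $t\in\mathbb Z_+$ acts as $f^{-t}$. *)

(* Defs.v *)
From HB Require Import structures.
From mathcomp Require Import all_boot all_order all_algebra.
From mathcomp Require Import all_classical.
From mathcomp Require Import topology.

Set Implicit Arguments.
Unset Strict Implicit.
Unset Printing Implicit Defensive.

Local Open Scope classical_set_scope.

(* [zero_dimensional] of MathComp-Analysis only says that clopen sets separate
   points; here the space has a base of clopen sets. *)
Definition zero_dimensional_space (X : topologicalType) : Prop :=
  basis [set U : set X | clopen U].

Record homeomorphism_pair (X : topologicalType) (f g : X -> X) : Prop := {
  homeomorphism_fK : cancel f g;
  homeomorphism_gK : cancel g f;
  homeomorphism_f_continuous : continuous f;
  homeomorphism_g_continuous : continuous g }.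

Record directed_preorder (D : Type) (le : D -> D -> Prop) : Prop := {
  directed_inhabited : exists d : D, True;
  directed_refl : forall d, le d d;
  directed_trans : forall d1 d2 d3, le d1 d2 -> le d2 d3 -> le d1 d3;
  directed_ub : forall d1 d2, exists d, le d1 d /\ le d2 d }.

Definition tails (D : Type) (le : D -> D -> Prop) : set_system D :=
  filter_from [set: D] (fun d => [set e | le d e]).

Section Actions.
Variable X : Type.

Definition act_plus (f : X -> X) (t : nat) (x : X) : X := iter t f x.

(* [g] is the inverse of [f]. *)
Definition act_minus (g : X -> X) (t : nat) (x : X) : X := iter t g x.

(* [Negz n] is the integer -(n+1). *)
Definition act_int (f g : X -> X) (t : int) (x : X) : X :=
  match t with
  | Posz n => iter n f x
  | Negz n => iter n.+1 g x
  end.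

End Actions.

Definition semi_recurrent_at (X : topologicalType) (act : nat -> X -> X)
    (x : X) : Prop :=
  exists (D : Type) (le : D -> D -> Prop) (t : D -> nat),
    [/\ directed_preorder le,
        t d @[d --> tails le] --> \oo &
        act (t d) x @[d --> tails le] --> x].

Definition recurrent_at (X : topologicalType) (f g : X -> X) (x : X) : Prop :=
  semi_recurrent_at (act_plus f) x /\ semi_recurrent_at (act_minus g) x.

(* The acting semigroup [T] is discrete, so its compact subsets are the finite
   ones. *)
Definition weakly_almost_periodic (T : Type) (X : uniformType)
    (act : T -> X -> X) : Prop :=
  forall alpha : set (X * X), entourage alpha ->
    exists K : set T, finite_set K /\
      forall (x : X) (t : T),
        [set act k (act t x) | k in K] `&` xsection alpha x !=set0.

(* Main.v *)
(** Let [f] be pointwise recurrent and [U] clopen. By compactness the return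
times of points of [U] to [U] are bounded by some [N], so the forward saturation
[V] of [U] is the union of [U], ..., [f^(N-1) U]. Then [V] is clopen and
[f V `<=` V]; the open set of the points of [V] outside [f V] is wandering, hence
empty by recurrence, and [V] is invariant under [f] and its inverse. Every point
of [V] therefore reaches [U] within [N] steps in both time directions, which is
weak almost periodicity of all three actions. *)
Require Import Defs.
From HB Require Import structures.
From mathcomp Require Import all_boot all_order all_algebra.
From mathcomp Require Import all_classical.
From mathcomp Require Import topology.

Set Implicit Arguments.
Unset Strict Implicit.
Unset Printing Implicit Defensive.

Local Open Scope classical_set_scope.

Lemma iter_continuous (X : topologicalType) (f : X -> X) (n : nat) :
  continuous f -> continuous (iter n f).
Proof.
move=> fC; elim: n => [|n IHn] x; first exact: cvg_id.
exact: (cvg_comp _ _ (IHn x) (fC _)).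
Qed.

Lemma iter_cancel_le (X : Type) (f g : X -> X) (m n : nat) (x : X) :
  cancel f g -> (m <= n)%N -> iter m g (iter n f x) = iter (n - m) f x.
Proof.
move=> fK; elim: m n x => [|m IHm] n x; first by rewrite subn0.
by case: n => // n le_mn; rewrite iterSr /= fK IHm.
Qed.

Lemma finite_set_nat_ub (K : set nat) :
  finite_set K -> exists N, forall k, K k -> (k <= N)%N.
Proof.
case/finite_fsetP => A ->; exists (\max_(k <- finmap.enum_fset A) k)%N => k Ak.
exact: leq_bigmax_seq.
Qed.

Section Recurrence.
Variables (X : topologicalType) (f : X -> X) (x : X).

Lemma semi_recurrent_return (U : set X) (n : nat) :
  semi_recurrent_at (act_plus f) x -> nbhs x U ->
  exists2 t, (n <= t)%N & U (iter t f x).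
Proof.
case=> D [le [t [[[d0 _] _ _ le_ub] t_oo t_x]]] xU.
have [d1 _ d1U] := t_x _ xU.
have [d2 _ d2n] := t_oo _ (nbhs_infty_ge n).
have [d [d1d d2d]] := le_ub d1 d2.
by exists (t d); [exact: d2n | exact: d1U].
Qed.

Lemma return_semi_recurrent :
  (forall U : set X, nbhs x U -> forall n,
    exists2 t, (n <= t)%N & U (iter t f x)) ->
  semi_recurrent_at (act_plus f) x.
Proof.
move=> ret.
(* The index set is that of pairs (neighbourhood, time at which the orbit is in it), ordered by
   reverse inclusion and by time. Arbitrarily late returns to the intersection of two neighbourhoods
   make it directed. *)
pose D := {d : set X * nat | nbhs x d.1 /\ d.1 (iter d.2 f x)}.
pose le (d e : D) := (sval e).1 `<=` (sval d).1 /\ ((sval d).2 <= (sval e).2)%N.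
have D_ex U n : nbhs x U -> exists2 d : D, (sval d).1 = U & (n <= (sval d).2)%N.
  move=> xU; have [t le_nt Ut] := ret U xU n.
  by exists (exist _ (U, t) (conj xU Ut)).
have le_ub d1 d2 : exists d, le d1 d /\ le d2 d.
  have [] := D_ex ((sval d1).1 `&` (sval d2).1) (maxn (sval d1).2 (sval d2).2).
    by apply: filterI; [exact: (svalP d1).1 | exact: (svalP d2).1].
  move=> d dE; rewrite geq_max => /andP[le1 le2].
  by exists d; rewrite /le dE; split; split => // ? [].
exists D, le, (fun d => (sval d).2); split.
- split=> //.
  + by have [d _ _] := D_ex setT 0%N filterT; exists d.
  + by move=> d; split.
  + move=> d1 d2 d3 [s12 l12] [s23 l23]; split; first exact: subset_trans s12.
    exact: leq_trans l23.
- move=> A [n _ nA]; have [d _ le_nd] := D_ex setT n filterT.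
  by exists d => // e [_ le_de]; apply: nA => /=; exact: leq_trans le_de.
- move=> U xU; have [d dE _] := D_ex U 0%N xU.
  exists d => // e [s_ed _] /=; rewrite -dE; apply: s_ed.
  exact: (svalP e).2.
Qed.

End Recurrence.

Section WeaklyAlmostPeriodic.
Variable X : uniformType.

(** A small clopen [U] around a point gives a bound valid on all of [U], since its points are close
    to one another; compactness makes the bound uniform. The map [e] enumerates the candidates for
    the finite set [K]. *)
Lemma weakly_almost_periodic_clopen (T : Type) (act : T -> X -> X)
    (e : nat -> T) :
    compact [set: X] -> zero_dimensional_space X ->
    (forall U : set X, clopen U -> exists N, forall x t, U x ->
       exists2 k, (k < N)%N & U (act (e k) (act t x))) ->
  weakly_almost_periodic act.
Proof.
move=> /compact_near_coveringP X_compact [_ X_basis] ret alpha alpha_ent.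
pose P N x := forall t, exists2 k, (k < N)%N & alpha (x, act (e k) (act t x)).
have [x _|N _ PN] := X_compact nat \oo P _.
  (* Both orientations are needed: a point [y] of [U] and its return are compared through [x], along
     (y, x) and then (x, return). *)
  have sub_ent : nbhs x (xsection (split_ent alpha) x `&`
                         xsection (split_ent alpha)^-1%relation x).
    by apply: filterI; apply: nbhs_entourage.
  have [U [Uclopen Ux] Usub] := X_basis x _ sub_ent.
  have [N retN] := ret U Uclopen.
  exists (U, [set n | (N <= n)%N]) => /=.
    split; last exact: nbhs_infty_ge.
    by apply: open_nbhs_nbhs; split; [exact: Uclopen.1 |].
  move=> [y n] /= [Uy le_Nn] t; have [k lt_kN Uk] := retN y t Uy.
  exists k; first exact: leq_trans le_Nn.
  have [_ /xsectionP yx] := Usub _ Uy; have [/xsectionP xk _] := Usub _ Uk.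
  exact: (entourage_split x).
exists (e @` `I_N); split; first exact/finite_image/finite_II.
move=> x t; have [k lt_kN ak] := PN N (leqnn N) x I t.
exists (act (e k) (act t x)); split; last exact/xsectionP.
by exists (e k) => //; exists k.
Qed.

Lemma act_plus_wap_recurrent (f : X -> X) :
  weakly_almost_periodic (act_plus f) ->
  forall x, semi_recurrent_at (act_plus f) x.
Proof.
move=> wap x; apply: return_semi_recurrent => U.
rewrite nbhsP => -[alpha /wap[K [_ ret]] sub_aU] n.
have [_ [[k _ <-] ak]] := ret x n.
exists (k + n)%N; first exact: leq_addl.
by apply: sub_aU; rewrite iterD.
Qed.

Lemma act_int_wap_recurrent (f g : X -> X) :
  cancel f g -> weakly_almost_periodic (act_int f g) ->
  forall x, semi_recurrent_at (act_plus f) x.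
Proof.
move=> fK wap x; apply: return_semi_recurrent => U.
rewrite nbhsP => -[alpha /wap[K [finK ret]] sub_aU] n.
have [N leN] := finite_set_nat_ub (finite_image absz finK).
(* [K] may contain negative integers, but none below -N; starting from time n + N + 1 keeps the
   total time at least n. *)
have [_ [[k Kk <-] ak]] := ret x (Posz (n + N.+1)).
have {}leN : (absz k <= N)%N by apply: leN; exists k.
have {}ak := sub_aU _ ak.
case: k Kk leN ak => k Kk /= leN ak.
  exists (k + (n + N.+1))%N; first by rewrite addnCA leq_addr.
  by rewrite iterD.
exists (n + N.+1 - k.+1)%N; first by rewrite -addnBA ?leq_addr // ltnW.
rewrite -(iter_cancel_le _ fK) //.
by rewrite (leq_trans leN) // -addSnnS leq_addl.
Qed.

End WeaklyAlmostPeriodic.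

Section ReturnTimes.
Variables (X : topologicalType) (f : X -> X).
Hypothesis X_compact : compact [set: X].
Hypothesis f_continuous : continuous f.
Hypothesis f_recurrent : forall x, semi_recurrent_at (act_plus f) x.

Lemma bounded_return_time (U : set X) : clopen U ->
  exists N, forall x, U x -> exists2 n, (n < N)%N & U (iter n.+1 f x).
Proof.
move=> [Uopen Uclosed].
have /compact_near_coveringP U_compact : compact U.
  exact: subclosed_compact Uclosed X_compact _.
(* A return time n + 1 of [x] also serves all nearby points, because [U] is open and the iterate is
   continuous. *)
pose P N x := exists2 n, (n < N)%N & U (iter n.+1 f x).
have [x Ux|N _ PN] := U_compact nat \oo P _.
  have [[|n] // _ Un] :=
    semi_recurrent_return 1 (f_recurrent x) (open_nbhs_nbhs (conj Uopen Ux)).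
  exists (iter n.+1 f @^-1` U, [set m | (n < m)%N]) => /=.
    split; last exact: nbhs_infty_ge.
    apply: (iter_continuous (n := n.+1) f_continuous).
    exact: open_nbhs_nbhs.
  by move=> [y m] /= [Uy lt_nm]; exists n.
by exists N => x Ux; exact: (PN N (leqnn N)).
Qed.

Variable g : X -> X.
Hypothesis fK : cancel f g.
Hypothesis gK : cancel g f.
Hypothesis g_continuous : continuous g.

Lemma clopen_bounded_return (U : set X) : clopen U ->
  exists (V : set X) (N : nat), [/\ U `<=` V,
    forall x, V x -> V (f x), forall x, V x -> V (g x),
    forall x, V x -> exists2 n, (n < N)%N & U (iter n f x) &
    forall x, V x -> exists2 n, (n < N)%N & U (iter n g x)].
Proof.
move=> Uclopen; have [N retN] := bounded_return_time Uclopen.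
(* That is, x = f^n u with u in [U] and n < N. *)
pose V := [set x | exists2 n, (n < N)%N & U (iter n g x)].
have UV : U `<=` V.
  move=> x Ux; have [n lt_nN _] := retN x Ux.
  by exists 0%N => //; exact: leq_ltn_trans lt_nN.
(* Write x = f^n u and let m + 1 be a return time of u. If n < m, then n + 1 < N still serves for f
   x; otherwise restart from f^(m+1) u in [U], with n - m steps left. *)
have fV x : V x -> V (f x).
  move=> [n lt_nN Un]; have [m lt_mN Um] := retN _ Un.
  have [lt_nm|le_mn] := ltnP n m.
    exists n.+1; first exact: leq_ltn_trans lt_mN.
    by rewrite iterSr fK.
  exists (n - m)%N; first exact: leq_ltn_trans (leq_subr _ _) lt_nN.
  suff -> : iter (n - m) g (f x) = iter m.+1 f (iter n g x) by [].
  by rewrite -[x in RHS]fK -(iterSr n g) (iter_cancel_le _ gK) ?subSS.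
have fVn n x : V x -> V (iter n f x) by elim: n => //= n IHn /IHn; exact: fV.
have gV x : V x -> V (g x).
  move=> Vx; apply: contrapT => nVgx.
  (* The condition says that g y is outside [V], which is open in y as a finite intersection. A
     positive return f^(t+1) x satisfies it, yet g sends that point to f^t x, which lies in [V]. *)
  have near_nV : \forall y \near x, forall n : 'I_N, ~ U (iter n.+1 g y).
    apply: filter_forall => n.
    have nUn : (~` U) (iter n.+1 g x).
      by move=> Un; apply: nVgx; exists n => //; rewrite -iterSr.
    apply: (iter_continuous (n := n.+1) g_continuous (t := ~` U)).
    by apply: open_nbhs_nbhs; split=> //; exact/closed_openC/Uclopen.2.
  have [[|t] // _ nVt] := semi_recurrent_return 1 (f_recurrent x) near_nV.
  have [n lt_nN Un] := fVn t x Vx.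
  by apply: (nVt (Ordinal lt_nN)); rewrite iterSr iterS fK.
exists V, N.+1; split=> // x Vx; last first.
  by have [n lt_nN Un] := Vx; exists n => //; exact: ltnW.
(* Looking back from f^N x reaches [U] at f^(N-n) x; as N - n can equal N, the common bound is N +
   1. *)
have [n lt_nN Un] := fVn N x Vx.
exists (N - n)%N; first by rewrite ltnS leq_subr.
by rewrite -(iter_cancel_le _ fK) // ltnW.
Qed.

End ReturnTimes.

Lemma recurrent_wap (X : uniformType) (f g : X -> X) :
    compact [set: X] -> zero_dimensional_space X -> homeomorphism_pair f g ->
    (forall x, semi_recurrent_at (act_plus f) x) ->
  [/\ weakly_almost_periodic (act_plus f), weakly_almost_periodic (act_minus g)
    & weakly_almost_periodic (act_int f g)].
Proof.
move=> X_compact X_basis [fK gK fC gC] f_rec.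
have ret := clopen_bounded_return X_compact fC f_rec fK gK gC.
have iterV (h : X -> X) (V : set X) n : (forall x, V x -> V (h x)) ->
    forall x, V x -> V (iter n h x).
  by move=> hV x Vx; elim: n => //= n; exact: hV.
split; [apply: (weakly_almost_periodic_clopen (e := id))
       |apply: (weakly_almost_periodic_clopen (e := id))
       |apply: (weakly_almost_periodic_clopen (e := Posz))] => // U /ret;
  move=> [V [N [UV fV gV retf retg]]]; exists N => x t /UV Vx.
- by apply: retf; exact: iterV.
- by apply: retg; exact: iterV.
- by apply: retf; case: t => n; exact: iterV.
Qed.

Theorem theorem7p12 (X : uniformType) (f g : X -> X)
    (X_compact : compact [set: X]) (X_hausdorff : hausdorff_space X)
    (X_zero_dim : zero_dimensional_space X)
    (fg_homeo : homeomorphism_pair f g) :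
  [<-> (forall x : X, semi_recurrent_at (act_plus f) x);
       (forall x : X, semi_recurrent_at (act_minus g) x);
       weakly_almost_periodic (act_plus f);
       weakly_almost_periodic (act_minus g);
       weakly_almost_periodic (act_int f g);
       (forall x : X, recurrent_at f g x)].
Proof.
have [fK gK fC gC] := fg_homeo.
(* [act_plus] and [act_minus] have the same body, so exchanging [f] and [g] transfers every forward
   result to backward orbits. *)
have gf_homeo : homeomorphism_pair g f by [].
have wap_f := recurrent_wap X_compact X_zero_dim fg_homeo.
have wap_g := recurrent_wap X_compact X_zero_dim gf_homeo.
tfae.
- by move=> /wap_f[_ /act_plus_wap_recurrent].
- by move=> /wap_g[].
- by move=> /act_plus_wap_recurrent /wap_f[].
(* Backward recurrence makes the forward action weakly almost periodic, hence recurrent, and this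
   gives the integer action. *)
- move=> /act_plus_wap_recurrent /wap_g[_ /act_plus_wap_recurrent /wap_f[]] //.
- move=> /(act_int_wap_recurrent fK) f_rec x; split=> //.
  have [_ /act_plus_wap_recurrent g_rec _] := wap_f f_rec; exact: g_rec.
- by move=> rec x; have [] := rec x.
Qed.
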